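(* For every integer $k\geq 5$ there exists a graph $D_n$ on $n = k^2+k-1$ vertices such that $\deg(x)+\deg(y)\geq \frac{2n-2k+1}{k}$ for any two non-adjacent vertices $x$ and $y$ of $D_n$, and $D_n$ has $k-1$ cut edges.
   Context: All graphs are finite, simple and undirected; $\deg(x)$ is the degree of $x$; a cut edge is an edge whose removal disconnects the graph. *)

(* Defs.v *)
From mathcomp Require Import all_boot all_order all_algebra.

Set Implicit Arguments.
Unset Strict Implicit.
Unset Printing Implicit Defensive.

Record sgraph (T : finType) := SGraph {
  adj :> rel T;
  adj_sym : symmetric adj;
  adj_irrefl : irreflexive adj }.

Section Graphs.
Variable T : finType.
Implicit Types (e : rel T) (G : sgraph T) (E : {set T}).

Definition deg G (x : T) : nat := #|[set y | G x y]|.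

(* Edges are unordered pairs, encoded as two-element sets of vertices. *)
Definition edges G : {set {set T}} :=
  [set E | [exists x, exists y, G x y && (E == [set x; y])]].

Definition is_connected e : bool := [forall x, forall y, connect e x y].

Definition del_edge e E : rel T := [rel x y | e x y && ([set x; y] != E)].

(* "Disconnects": the graph is connected and ceases to be so. *)
Definition is_cut_edge G E : bool :=
  [&& E \in edges G, is_connected G & ~~ is_connected (del_edge G E)].

Definition cut_edges G : {set {set T}} := [set E | is_cut_edge G E].

End Graphs.

(* Main.v *)
Require Import Defs.
From mathcomp Require Import all_boot all_order all_algebra.
From mathcomp Require Import zify.

(** Since [n = k^2 + k - 1], the required bound is [2k - 1/k], i.e. the degree
    sums must be at least [2k].  As [n = 1 + (k - 1)(k + 2)], one may take
    [k - 1] disjoint cliques on [k + 2] vertices and a hub joined to exactly one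
    vertex of each clique.  The hub has degree [k - 1] and every other vertex at
    least [k + 1]; the cut edges are exactly the [k - 1] edges at the hub,
    because every clique edge lies in a triangle. *)

Set Implicit Arguments.
Unset Strict Implicit.
Unset Printing Implicit Defensive.

Lemma del_edge_connect_sym (T : finType) (G : sgraph T) (E : {set T}) :
  connect_sym (del_edge G E).
Proof. by apply: sym_connect_sym => x y; rewrite /del_edge /= adj_sym setUC. Qed.

(** Rerouting: in any walk of [G], each use of the deleted edge, in either direction, can be
    replaced by the surviving path between its ends. *)
Lemma connect_del_edge (T : finType) (G : sgraph T) (x y : T) :
  connect (del_edge G [set x; y]) x y ->
  is_connected G -> is_connected (del_edge G [set x; y]).
Proof.
move=> cxy /forallP Gc; apply/forallP => u; apply/forallP => w.
have /forallP /(_ w) := Gc u; apply: connect_sub => {}u {}w Guw.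
have [Euw|nEuw] := eqVneq [set u; w] [set x; y]; last first.
  by apply: connect1; rewrite /del_edge /= Guw nEuw.
have neq_uw : u != w by apply: contraTneq Guw => ->; rewrite adj_irrefl.
have : u \in [set x; y] by rewrite -Euw set21.
have : w \in [set x; y] by rewrite -Euw set22.
rewrite !inE => /orP[] /eqP-> /orP[] /eqP -> //; by rewrite del_edge_connect_sym.
Qed.

Section StarOfCliques.

(* Vertices are labelled by [option (A * B)]: [None] is the hub, and
   [Some (a, b)] is the vertex [b] of clique [a]; the hub is attached to the
   vertices [Some (a, b0)]. *)
Variables (A B T : finType) (b0 : B).
Variables (v : option (A * B) -> T) (l : T -> option (A * B)).
Hypotheses (vK : cancel v l) (lK : cancel l v).

Definition star_adj (p q : option (A * B)) : bool :=
  match p, q with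
  | Some (a, b), Some (a', b') => (a == a') && (b != b')
  | None, Some (_, b) | Some (_, b), None => b == b0
  | None, None => false
  end.

Lemma star_adj_sym : symmetric (relpre l star_adj).
Proof.
move=> x y /=; case: (l x) (l y) => [[a b]|] [[a' b']|] //=.
by rewrite eq_sym (eq_sym b).
Qed.

Lemma star_adj_irrefl : irreflexive (relpre l star_adj).
Proof. by move=> x /=; case: (l x) => [[a b]|] //=; rewrite !eqxx. Qed.

(** Pulling back along [l] lets the graph live on any type in bijection with the labels, in the end
    ['I_n]. *)
Definition star : sgraph T := SGraph star_adj_sym star_adj_irrefl.

Lemma star_v p q : star (v p) (v q) = star_adj p q.
Proof. by rewrite /= !vK. Qed.

Lemma deg_star_hub : #|A| <= deg star (v None).
Proof.
have inj : injective (fun a => v (Some (a, b0))).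
  by move=> a a' /(can_inj vK) [].
rewrite -(card_codom inj); apply/subset_leq_card/subsetP => _ /codomP[a ->].
by rewrite inE star_v /= eqxx.
Qed.

Lemma deg_star_clique a b : #|B|.-1 <= deg star (v (Some (a, b))).
Proof.
have inj : injective (fun b' => v (Some (a, b'))).
  by move=> b1 b2 /(can_inj vK) [].
rewrite -(cardC1 b) -(card_image inj); apply/subset_leq_card/subsetP.
move=> _ /imageP[b' nb' ->].
by rewrite inE star_v /= eqxx /= eq_sym.
Qed.

(** Distinct vertices are not both the hub. A hub and a clique vertex give the bound directly; for
    two clique vertices, [#|A| < #|B|] makes [#|B|.-1] at least [#|A|]. *)
Lemma deg_star_nonadj x y : #|A| < #|B| -> x != y -> ~~ star x y ->
  #|A| + #|B|.-1 <= deg star x + deg star y.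
Proof.
move=> ltAB; rewrite -(lK x) -(lK y).
case: (l x) (l y) => [[a b]|] [[a' b']|] nxy _; last by rewrite eqxx in nxy.
- by have := deg_star_clique a b; have := deg_star_clique a' b'; lia.
- by have := deg_star_clique a b; have := deg_star_hub; lia.
- by have := deg_star_clique a' b'; have := deg_star_hub; lia.
Qed.

Lemma star_connected : is_connected star.
Proof.
have sym : connect_sym star by apply/sym_connect_sym/star_adj_sym.
have to_hub x : connect star (v None) x.
  rewrite -(lK x); case: (l x) => [[a b]|] //.
  apply: (@connect_trans _ _ (v (Some (a, b0)))).
    by apply: connect1; rewrite star_v /=.
  have [->|nb] := eqVneq b b0 => //.
  by apply: connect1; rewrite star_v /= eqxx eq_sym.
apply/forallP => x; apply/forallP => y.
by apply: connect_trans (to_hub y); rewrite sym.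
Qed.

Lemma hub_edge_cut a : is_cut_edge star [set v None; v (Some (a, b0))].
Proof.
set E := [set _; _]; apply/and3P; split; last 1 first.
(* [S] is clique [a]: the deleted edge is its only link to the outside, so [S] becomes closed, yet
   it contains just one end of that edge. *)
- pose S := [pred x | if l x is Some (a', _) then a' == a else false].
  have clS : closed (del_edge star E) S.
    apply: intro_closed; first exact: del_edge_connect_sym.
    move=> x y; rewrite -(lK x) -(lK y) !inE !vK.
    case: (l x) (l y) => [[a1 b1]|] [[a2 b2]|] //=; rewrite /del_edge /= !vK /=.
      by case/andP => /andP[/eqP->].
    by case/andP=> /eqP-> nE /eqP eqa; rewrite eqa setUC eqxx in nE.
  apply/negP => /forallP /(_ (v None)) /forallP /(_ (v (Some (a, b0)))).
  by move/(closed_connect clS); rewrite !inE !vK eqxx.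
- rewrite inE; apply/existsP; exists (v None); apply/existsP.
  by exists (v (Some (a, b0))); rewrite star_v /= !eqxx.
- exact: star_connected.
Qed.

Lemma clique_edge_not_cut a b b' : 2 < #|B| -> b != b' ->
  ~~ is_cut_edge star [set v (Some (a, b)); v (Some (a, b'))].
Proof.
move=> B3 nbb'; rewrite /is_cut_edge !negb_and negbK; apply/orP; right.
apply/orP; right; apply: connect_del_edge star_connected.
(* A third clique vertex [d] provides the detour from [b] to [b'] through a triangle. *)
have [d] : exists d, d \notin [set b; b'].
  apply/existsP; rewrite -negb_forall; apply: contraTN B3 => /forallP all2.
  rewrite -leqNgt -cardsT; have -> : [set: B] = [set b; b'].
    by apply/setP => d; rewrite in_setT all2.
  by rewrite cards2 ltnS leq_b1.
rewrite !inE negb_or => /andP[ndb ndb'].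
have vE c c' : (v (Some (a, c)) == v (Some (a, c'))) = (c == c').
  by rewrite (can_eq vK); apply/eqP/eqP => [[]|->].
(* Both detour edges contain this vertex, so neither is the deleted edge. *)
have nd : v (Some (a, d)) \notin [set v (Some (a, b)); v (Some (a, b'))].
  by rewrite !inE !vE negb_or ndb.
apply: (@connect_trans _ _ (v (Some (a, d)))); apply: connect1;
  apply/andP; split; rewrite ?star_v /= ?eqxx //=.
- by rewrite eq_sym.
- by apply: contraNneq nd => <-; rewrite set22.
- by apply: contraNneq nd => <-; rewrite set21.
Qed.

Lemma cut_edges_star : 2 < #|B| ->
  cut_edges star = [set [set v None; v (Some (a, b0))] | a : A].
Proof.
move=> B3; apply/setP => E; rewrite inE; apply/idP/imsetP; last first.
  by case=> a _ ->; apply: hub_edge_cut.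
move=> cutE; have /and3P[+ _ _] := cutE; rewrite inE.
case/existsP => x /existsP[y] /andP[]; rewrite -(lK x) -(lK y) star_v.
case: (l x) (l y) => [[a b]|] [[a' b']|] //=.
- case/andP=> /eqP<- nb /eqP EE; move: cutE.
  by rewrite EE (negPf (clique_edge_not_cut _ _ _)).
- by move=> /eqP-> /eqP->; exists a => //; rewrite setUC.
- by move=> /eqP-> /eqP->; exists a'.
Qed.

Lemma card_cut_edges_star : 2 < #|B| -> #|cut_edges star| = #|A|.
Proof.
move=> B3; rewrite cut_edges_star // card_imset // => a a' eqE.
(* A hub edge determines its clique through its end other than the hub. *)
have : v (Some (a, b0)) \in [set v None; v (Some (a', b0))].
  by rewrite -eqE set22.
by rewrite !inE !(can_eq vK) /= => /eqP[].
Qed.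

End StarOfCliques.

Theorem theorem3p5 (k : nat) (hk : (5 <= k)%N) :
  let n := (k ^ 2 + k - 1)%N in
  exists D : sgraph 'I_n,
    (forall x y : 'I_n, x != y -> ~~ D x y ->
       ((2 * n%:R - 2 * k%:R + 1) / k%:R <= (deg D x + deg D y)%N%:R :> rat)%R)
    /\ #|cut_edges D| = (k - 1)%N.
Proof.
move=> n; pose V : finType := option ('I_(k - 1) * 'I_k.+2).
have cardV : #|V| = n by rewrite card_option card_prod !card_ord /n; nia.
pose v (p : V) : 'I_n := cast_ord cardV (enum_rank p).
pose l (x : 'I_n) : V := enum_val (cast_ord (esym cardV) x).
have vK : cancel v l by move=> p; rewrite /l /v cast_ordK enum_rankK.
have lK : cancel l v by move=> x; rewrite /l /v enum_valK cast_ordKV.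
exists (star (ord0 : 'I_k.+2) l); split; last first.
  by rewrite (card_cut_edges_star _ vK lK) card_ord //; lia.
move=> x y nxy nadj.
have := deg_star_nonadj vK lK _ nxy nadj; rewrite !card_ord => /(_ ltac:(lia)).
set d := (_ + deg _ y)%N => le_d.
have k_gt0 : (0 < k%:R :> rat)%R by rewrite Num.Theory.ltr0n; lia.
(* Clearing the denominator and the subtraction leaves [2 * n + 1 <= d * k + 2 * k] over the
   naturals. By [le_d], [d] is at least [(k - 1) + (k + 1) = 2 * k], while
   [2 * n + 1 = 2 * k ^ 2 + 2 * k - 1]. *)
rewrite Num.Theory.ler_pdivrMr // GRing.addrAC Num.Theory.lerBlDr.
rewrite -!GRing.natrM GRing.natr1 -GRing.natrD Num.Theory.ler_nat.
by rewrite /n; nia.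
Qed.
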